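(* Let $A,B^f\in\mathbb{R}^{n\times n}$ with $B^f$ invertible, let $\|\cdot\|$ be a norm on $\mathbb{R}^n$, let $T\ge1$ and $w\ge 0$ be integers, and consider the online problem $$\min_{y_1,\dots,y_T\in\mathbb{R}^n}\ \sum_{t=1}^T c_t(y_t)+\|(B^f)^{-1}(y_t-Ay_{t-1})\|,\qquad y_0=0,$$ where $c_t(y)=c_x(y+v_t)$ with $c_x:\mathbb{R}^n\to\mathbb{R}$ convex and $v_t\in\mathbb{R}^n$ arbitrary. Suppose each $c_t$ is $m$-strongly convex ($m>0$) and bounded below by a positive constant $c_0$. Then the competitive ratio of the algorithm AFHC with prediction window size $w$ for this problem is at most $$1+\frac{\|(B^f)^{-1}A\|^2}{2m(w+1)c_0},$$ and in particular is $1+O(1/w)$.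
   Context: Conventions: $\|(B^f)^{-1}A\|$ is the matrix norm induced by $\|\cdot\|$. A function $h$ is $m$-strongly convex if $h(\lambda x+(1-\lambda)y)\le\lambda h(x)+(1-\lambda)h(y)-\frac m2\lambda(1-\lambda)\|x-y\|^2$ for all $x,y$ and $\lambda\in[0,1]$, with respect to the norm $\|\cdot\|$ of the problem. The functions $c_t$ are revealed online; with prediction window $w$, when choosing at time $s$ the algorithm knows $c_s,\dots,c_{s+w}$ exactly. Fixed Horizon Control: for $j=1,\dots,w+1$, the $j$-th FHC algorithm recomputes its trajectory at times $s\in\{j,\,j+(w+1),\,j+2(w+1),\dots\}$: at each such $s\le T$ it chooses $y^j_s,\dots,y^j_{\min(s+w,T)}$ to minimize $$\sum_{t=s}^{\min(s+w,T)}c_t(y_t)+\|(B^f)^{-1}(y_s-Ay^j_{s-1})\|+\sum_{t=s+1}^{\min(s+w,T)}\|(B^f)^{-1}(y_t-Ay_{t-1})\|,$$ where $y^j_{s-1}$ is its own previous point and $y^j_0=0$. If $j>1$, the initial times $1,\dots,\min(j-1,T)$ are treated as a first, truncated window: at time $1$ it chooses the points at these times to minimize the total cost over them starting from $y_0=0$. AFHC (Averaging Fixed Horizon Control) plays $y_t=\frac{1}{w+1}\sum_{j=1}^{w+1}y^j_t$ (equivalently, it averages the control actions $f_t=(B^f)^{-1}(y_t-Ay_{t-1})$ of the $w+1$ FHC algorithms). The competitive ratio of an algorithm is the supremum, over all inputs (sequences $(v_t)$), of the ratio of its total cost to the minimum (offline optimal) total cost. *)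

(* Defs.v *)
From HB Require Import structures.
From mathcomp Require Import all_boot all_order all_algebra.
From mathcomp Require Import all_classical all_reals all_analysis.

Set Implicit Arguments.
Unset Strict Implicit.
Unset Printing Implicit Defensive.
Import Order.TTheory GRing.Theory Num.Theory.
Local Open Scope classical_set_scope.
Local Open Scope ring_scope.

(* An arbitrary norm on R^n is a bare function, because 'cV[R]_n already
   carries the sup norm as its canonical norm. *)
Record is_norm (R : realType) (n : nat) (nrm : 'cV[R]_n -> R) : Prop := IsNorm {
  is_norm_eq0 : forall x, nrm x = 0 -> x = 0;
  is_normZ : forall (a : R) x, nrm (a *: x) = `|a| * nrm x;
  is_normD : forall x y, nrm (x + y) <= nrm x + nrm y }.

Definition induced_norm (R : realType) (n : nat) (nrm : 'cV[R]_n -> R)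
    (M : 'M[R]_n) : R :=
  sup [set nrm (M *m x) | x in [set x | nrm x <= 1]].

Definition strongly_convex (R : realType) (n : nat) (nrm : 'cV[R]_n -> R)
    (m : R) (h : 'cV[R]_n -> R) : Prop :=
  forall (x y : 'cV[R]_n) (l : R), 0 <= l <= 1 ->
    h (l *: x + (1 - l) *: y)
      <= l * h x + (1 - l) * h y - m / 2 * l * (1 - l) * nrm (x - y) ^+ 2.

(* The hitting cost at time t for the input sequence v. *)
Definition hitting (R : realType) (n : nat) (cx : 'cV[R]_n -> R)
    (v : nat -> 'cV[R]_n) (t : nat) (y : 'cV[R]_n) : R :=
  cx (y + v t).

Section online_problem.
Context (R : realType) (n : nat) (A B : 'M[R]_n) (nrm : 'cV[R]_n -> R).

Implicit Types (c : nat -> 'cV[R]_n -> R) (y z : nat -> 'cV[R]_n).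

(* Trajectories are indexed from 0; y 0 is the initial point, and values at
   times beyond the horizon are never used. *)

(* Cost over the times a, ..., b (with a >= 1); the point y (a - 1) only enters
   through the switching cost at time a. *)
Definition window_cost c (a b : nat) y : R :=
  \sum_(a <= t < b.+1) (c t (y t) + nrm (invmx B *m (y t - A *m y t.-1))).

Definition offline_opt c (T : nat) : R :=
  inf [set window_cost c 1 T y | y in [set y | y 0%N = 0]].

(* [a, b] is one of the windows on which the j-th FHC algorithm optimizes. *)
Definition fhc_window (T w j a b : nat) : Prop :=
  (exists k, [/\ a = (j + k * w.+1)%N, (a <= T)%N & b = minn (a + w) T])
  \/ [/\ (1 < j)%N, a = 1%N & b = minn j.-1 T].

(* y is a trajectory of the j-th FHC algorithm: on each of its windows [a, b],
   the points y a, ..., y b minimize the cost of the window among all choices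
   starting from the same previous point y (a - 1). *)
Definition is_fhc (T w j : nat) c y : Prop :=
  y 0%N = 0 /\
  forall a b, fhc_window T w j a b ->
  forall z, z a.-1 = y a.-1 -> window_cost c a b y <= window_cost c a b z.

(* Under strong convexity, the minimizers exist and the trajectory is uniquely
   determined on the times 0, ..., T, so that the choice made by xget only
   concerns the irrelevant times beyond T. *)
Definition fhc (T w j : nat) c : nat -> 'cV[R]_n :=
  xget (fun=> 0) [set y | is_fhc T w j c y].

Definition afhc (T w : nat) c : nat -> 'cV[R]_n :=
  fun t => w.+1%:R^-1 *: \sum_(1 <= j < w.+2) fhc T w j c t.

Definition competitive_ratio (cx : 'cV[R]_n -> R) (T : nat)
    (alg : (nat -> 'cV[R]_n -> R) -> (nat -> 'cV[R]_n)) : \bar R :=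
  ereal_sup [set (window_cost (hitting cx v) 1 T (alg (hitting cx v))
                    / offline_opt (hitting cx v) T)%:E
            | v in [set: nat -> 'cV[R]_n]].

End online_problem.

(* Main.v *)
Require Import Defs.
From mathcomp Require Import all_boot all_order all_algebra.
From mathcomp Require Import all_classical all_reals all_analysis.
From mathcomp Require Import zify ring lra.

Set Implicit Arguments.
Unset Strict Implicit.
Unset Printing Implicit Defensive.
Import Order.TTheory GRing.Theory Num.Theory.
Import numFieldNormedType.Exports.
Local Open Scope classical_set_scope.
Local Open Scope ring_scope.

(** Write K for the induced norm of B^-1 A and let z be any trajectory starting
    at 0. On a window [a, b], the j-th FHC trajectory y competes with the
    trajectory that jumps from its own point y (a - 1) to z at time a, and the
    jump costs at most K * d (a - 1) more than z does, where
    d t = nrm (z t - y t). Being a minimizer of a strongly convex function, y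
    beats this competitor by at least m / 2 times the sum of the d t ^ 2 over the
    window ([window_minimal_gap]); keeping only the last of these terms,
      cost y <= cost z + K * d (a - 1) - m / 2 * d b ^ 2
    on the window ([window_minimal_le]). Since
      K * d <= K ^ 2 / (2 m) + m / 2 * d ^ 2,
    and the next window starts right after b, the quadratic terms telescope, and
    each window costs the algorithm at most K ^ 2 / (2 m) more than z
    ([fhc_prefix_le]). The truncated first windows are free because d 0 = 0, and
    every time in 1, ..., T starts another window of exactly one of the w + 1
    algorithms; so these together lose at most
    T * K ^ 2 / (2 m) ([fhc_sum_le]). By convexity of the total cost, AFHC pays
    at most the mean of their costs ([afhc_cost_le]), and the optimum is at least
    T * c0, which gives the ratio. The second claim also uses that the ratio is
    at least 1, AFHC being feasible.

    All this presupposes that the window problems have minimizers and that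
    nrm (M x) <= (induced norm of M) * nrm x. Both rest on compactness in R^n,
    through two facts: a convex function on R^n is continuous
    ([convex_continuous]), and nrm dominates the sup norm
    ([nrm_lower_bound]). *)

(** * Convex functions on finite-dimensional spaces *)

(** The weights are plain reals, as in [strongly_convex], so that the inequality
    can be combined with linear arithmetic. *)
Definition is_convex (R : realType) (V : lmodType R) (f : V -> R) : Prop :=
  forall (x y : V) (l : R), 0 <= l <= 1 ->
    f (l *: x + (1 - l) *: y) <= l * f x + (1 - l) * f y.

(** Jensen's inequality for equal weights. It serves twice: AFHC is a uniform
    mean of trajectories, and a point near x in R^N is a uniform mean of points
    that differ from x in one coordinate. *)
Lemma convex_uniform_mean (R : realType) (V : lmodType R) (f : V -> R) :
  is_convex f -> forall k (x : 'I_k.+1 -> V),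
  f (k.+1%:R^-1 *: \sum_i x i) <= k.+1%:R^-1 * \sum_i f (x i).
Proof.
move=> cf; elim=> [x|k IH x].
  by rewrite !big_ord1 invr1 scale1r mul1r.
rewrite [in leLHS]big_ord_recr [in leRHS]big_ord_recr /=.
set s := \sum_(i < _) x _; set fs := \sum_(i < _) f _.
pose l : R := k.+1%:R / k.+2%:R.
have k1 : (k.+1%:R : R) != 0 by rewrite pnatr_eq0.
have k2 : (k.+2%:R : R) != 0 by rewrite pnatr_eq0.
have l1 : 1 - l = k.+2%:R^-1.
  by rewrite /l -[X in X - _](divff k2) -mulrBl -natrB // subSn // subnn mul1r.
have lk : l / k.+1%:R = k.+2%:R^-1 by rewrite /l mulrAC divff // mul1r.
have l01 : 0 <= l <= 1.
  by rewrite divr_ge0 //= -subr_ge0 l1 invr_ge0.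
(* the mean of k + 2 points puts weight (k + 1) / (k + 2) on the mean of the first
   k + 1 of them *)
have <- : l *: (k.+1%:R^-1 *: s) + (1 - l) *: x ord_max
    = k.+2%:R^-1 *: (s + x ord_max).
  by rewrite l1 scalerA lk scalerDr.
apply: le_trans (cf _ _ _ l01) _.
rewrite l1 mulrDr lerD2r.
apply: le_trans (ler_wpM2l _ (IH _)) _; first by case/andP: l01.
by rewrite mulrA lk.
Qed.

(** On the segment from x - e to x + e the graph of f lies below its two chords
    through x. *)
Lemma convex_segment_bound (R : realType) (V : lmodType R) (f : V -> R)
    (x e : V) (s : R) : is_convex f -> `|s| <= 1 ->
  f (x + s *: e) - f x <= `|s| * (`|f (x + e) - f x| + `|f (x - e) - f x|).
Proof.
move=> cf s1.
wlog s0 : e s s1 / 0 <= s => [hw|].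
  have [/hw|s0] := leP 0 s; first exact.
  have := hw (- e) (- s); rewrite normrN opprK scalerN scaleNr opprK.
  by rewrite [X in _ * X]addrC; apply => //; rewrite oppr_ge0 ltW.
rewrite ger0_norm // in s1 *.
have -> : x + s *: e = s *: (x + e) + (1 - s) *: x.
  by rewrite scalerDr addrAC -scalerDl addrCA subrr addr0 scale1r.
have := cf (x + e) x s; rewrite s0 s1 => /(_ isT) h.
have := ler_norm (f (x + e) - f x).
have := normr_ge0 (f (x - e) - f x).
nra.
Qed.

(** A displacement h is the mean of the N axis-parallel displacements N h_i e_i,
    each controlled by the chords of f from x to x + e_i and x - e_i. *)
Lemma convex_local_bound (R : realType) N (f : 'rV[R]_N -> R) (x : 'rV[R]_N) :
  is_convex f -> exists2 G, 0 <= G & forall h, N%:R * `|h| <= 1 ->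
    f (x + h) - f x <= N%:R * `|h| * G.
Proof.
case: N f x => [|N] f x cf.
  exists 0 => // h _; rewrite mulr0 (_ : h = 0) ?addr0 ?subrr //.
  by apply/rowP => -[].
exists (\sum_i (`|f (x + delta_mx 0 i) - f x| + `|f (x - delta_mx 0 i) - f x|)).
  by apply: sumr_ge0 => i _; rewrite addr_ge0.
move=> h h1.
have N1 : (N.+1%:R : R) != 0 by rewrite pnatr_eq0.
pose y i := x + (N.+1%:R * h 0 i) *: delta_mx 0 i.
have -> : x + h = N.+1%:R^-1 *: \sum_i y i.
  rewrite big_split /= sumr_const card_ord scalerDr -[x *+ _]scaler_nat scalerA mulVf //.
  rewrite scale1r scaler_sumr [in LHS](row_sum_delta h); congr (_ + _).
  by apply: eq_bigr => i _; rewrite scalerA mulrA mulVf // mul1r.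
have hi i : `|N.+1%:R * h 0 i| <= N.+1%:R * `|h|.
  rewrite normrM ger0_norm // ler_wpM2l //.
  by rewrite [leRHS]mx_normrE (le_trans _ (le_bigmax _ _ (0, i))).
set g := \sum_i (`|_| + `|_|).
apply: le_trans (lerB (convex_uniform_mean cf y) (lexx _)) _.
have -> : f x = N.+1%:R^-1 * \sum_(i < N.+1) f x.
  by rewrite sumr_const card_ord -[f x *+ _]mulr_natl mulrA mulVf // mul1r.
rewrite -mulrBr -sumrB.
apply: (@le_trans _ _ (N.+1%:R^-1 * (N.+1%:R * `|h| * g))); last first.
  have g0 : 0 <= g by apply: sumr_ge0 => i _; rewrite addr_ge0.
  by rewrite ler_piMl ?mulr_ge0 // invf_le1 ?ltr0n // ler1n.
rewrite ler_wpM2l ?invr_ge0 // /g mulr_sumr; apply: ler_sum => i _.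
apply: le_trans (convex_segment_bound _ _ cf (le_trans (hi i) h1)) _.
by apply: ler_wpM2r => //; rewrite addr_ge0.
Qed.

(** The local upper bound on f (x + h) - f x gives a lower bound too, because x is
    the midpoint of x + h and x - h. *)
Lemma convex_continuous (R : realType) N (f : 'rV[R]_N -> R) :
  is_convex f -> continuous f.
Proof.
move=> cf x; have [G G0 hG] := convex_local_bound x cf.
apply/(@cvgrPdist_le _ _ _ _ (nbhs_filter x)) => e e0.
pose K := N%:R * G + 1.
have K0 : 0 < K by rewrite ltr_wpDl // mulr_ge0.
apply/nbhs_ballP; exists (Num.min (e / K) N.+1%:R^-1) => /=.
  by rewrite lt_min invr_gt0 ltr0n divr_gt0.
move=> y; rewrite mx_norm_ball /ball_ /= distrC lt_min => /andP[/ltW hK /ltW hN].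
pose h := y - x.
have h1 : N%:R * `|h| <= 1.
  apply: (le_trans (ler_wpM2l _ hN)) => //.
  by rewrite ler_pdivrMr ?mul1r ?ler_nat // ltr0n.
have he : N%:R * `|h| * G <= e.
  move: hK (normr_ge0 h); rewrite -/h ler_pdivlMr // /K mulrDr mulr1; lra.
have yE : y = x + h by rewrite /h addrC subrK.
have up := hG _ h1.
have := hG (- h); rewrite normrN => /(_ h1) dn.
have l01 : 0 <= (2^-1 : R) <= 1 by lra.
have mid := cf (x + h) (x - h) _ l01.
have xE : 2^-1 *: (x + h) + (1 - 2^-1) *: (x - h) = x.
  have -> : 1 - 2^-1 = 2^-1 :> R by lra.
  rewrite -scalerDr addrACA subrr addr0 -mulr2n -[x *+ 2]scaler_nat scalerA mulVf //.
  by rewrite scale1r.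
rewrite xE in mid; rewrite yE ler_norml; apply/andP; split; lra.
Qed.

Lemma convex_coercive_min (R : realType) N (f : 'rV[R]_N -> R) (r : R) :
  is_convex f -> (forall x, f x <= f 0 -> `|x| <= r) ->
  exists c, forall x, f c <= f x.
Proof.
move=> cf fr; have ctf := convex_continuous cf.
pose S := [set x | f x <= f 0].
have S0 : S !=set0 by exists 0; rewrite /S /=.
have cS : compact S.
  apply: bounded_closed_compact.
    exists r; split; first exact: num_real.
    by move=> M rM x /fr /le_trans; apply; exact: ltW.
  by apply: (preimage_closed _ (@closed_le _ _)) => x _; exact: ctf.
have [c cS' cmin] := EVT_min_rV S0 cS (continuous_subspaceT ctf).
exists c => x; have [xS|xS] := leP (f x) (f 0); first by apply: cmin; rewrite inE.
by apply: le_trans (ltW xS); move: cS'; rewrite inE.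
Qed.

(** * Arbitrary norms on R^n *)

Section norm_theory.
Context (R : realType) (n : nat) (nrm : 'cV[R]_n -> R).
Hypothesis hnrm : is_norm nrm.

Lemma nrm0 : nrm 0 = 0.
Proof. by rewrite -(scale0r 0) is_normZ // normr0 mul0r. Qed.

Lemma nrm_ge0 x : 0 <= nrm x.
Proof.
have := is_normD hnrm x (- x).
rewrite subrr nrm0 -scaleN1r is_normZ // normrN1 mul1r; lra.
Qed.

Lemma nrm_convex_comb (x y : 'cV[R]_n) (l : R) : 0 <= l <= 1 ->
  nrm (l *: x + (1 - l) *: y) <= l * nrm x + (1 - l) * nrm y.
Proof.
case/andP=> l0 l1; apply: le_trans (is_normD hnrm _ _) _.
by rewrite !is_normZ // !ger0_norm // subr_ge0.
Qed.

Lemma nrm_tr_convex (M : 'M[R]_n) : is_convex (fun u : 'rV[R]_n => nrm (M *m u^T)).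
Proof.
move=> u v l l01; rewrite linearD !linearZ /= mulmxDr -!scalemxAr.
exact: nrm_convex_comb.
Qed.

(** The constant is the inverse of the minimum of nrm on the unit sphere of the
    sup norm. The points are row vectors, as in the Heine-Borel theorem. *)
Lemma nrm_lower_bound :
  exists2 k, 0 < k & forall u : 'rV[R]_n, `|u| <= k * nrm u^T.
Proof.
pose f (u : 'rV[R]_n) := nrm u^T.
have ctf : continuous f.
  apply: convex_continuous => u v l l01.
  by have := nrm_tr_convex 1%:M u v l01; rewrite !mul1mx.
pose S := [set u : 'rV[R]_n | `|u| = 1].
have [S0|S0] := pselect (S !=set0); last first.
  (* an empty sphere means that n = 0 *)
  exists 1 => // u; rewrite mul1r; suff -> : u = 0 by rewrite normr0 nrm_ge0.
  apply/eqP; apply: contra_notT S0 => u0; exists (`|u|^-1 *: u).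
  by rewrite /S /= normrZ normfV normr_id mulVf // normr_eq0.
have cS : compact S.
  apply: bounded_closed_compact.
    exists 1; split; first exact: num_real.
    by move=> M M1 x /= ->; exact: ltW.
  apply: (preimage_closed _ (@closed_eq _ 1)) => x _.
  exact: norm_continuous.
have [c + cmin] := EVT_min_rV S0 cS (continuous_subspaceT ctf).
rewrite inE /S /= => c1.
have fc0 : 0 < f c.
  rewrite lt_def nrm_ge0 andbT; apply/eqP => /(is_norm_eq0 hnrm) c0.
  by move: c1; rewrite -(trmxK c) c0 trmx0 normr0 => /esym/eqP; rewrite oner_eq0.
exists (f c)^-1; first by rewrite invr_gt0.
move=> u; rewrite mulrC ler_pdivlMr //.
have [->|u0] := eqVneq u 0; first by rewrite normr0 mul0r nrm_ge0.
have u0' : 0 < `|u| by rewrite normr_gt0.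
have := cmin (`|u|^-1 *: u).
rewrite inE /S /= normrZ normfV normr_id mulVf ?normr_eq0 // => /(_ erefl).
rewrite /f linearZ /= is_normZ // normfV normr_id mulrC ler_pdivlMr //.
by rewrite mulrC.
Qed.

(** The point is that the supremum defining the induced norm is finite: the unit
    ball of nrm lies in a sup-norm ball, on which nrm (M x) has a maximum. *)
Lemma induced_norm_le (M : 'M[R]_n) x : nrm (M *m x) <= induced_norm nrm M * nrm x.
Proof.
have [k k0 hk] := nrm_lower_bound.
pose D := [set u : 'rV[R]_n | `|u| <= k].
have cD : compact D.
  apply: bounded_closed_compact.
    exists k; split; first exact: num_real.
    by move=> e ke x' /= /le_trans; apply; exact: ltW.
  apply: (preimage_closed _ (@closed_le _ k)) => u _.
  exact: norm_continuous.
have D0 : D !=set0 by exists 0; rewrite /D /= normr0 ltW.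
have ctf := convex_continuous (nrm_tr_convex M).
have [c _ cmax] := EVT_max_rV D0 cD (continuous_subspaceT ctf).
have hub : has_ubound [set nrm (M *m y) | y in [set y | nrm y <= 1]].
  exists (nrm (M *m c^T)) => _ [y /= y1 <-].
  rewrite -(trmxK y); apply: cmax; rewrite inE /D /=.
  by rewrite (le_trans (hk _)) // trmxK ler_piMr // ltW.
have [x0|x0] := eqVneq (nrm x) 0.
  by rewrite (is_norm_eq0 hnrm x0) mulmx0 nrm0 mulr0.
have x0' : 0 < nrm x by rewrite lt_def x0 nrm_ge0.
rewrite -ler_pdivrMr //; apply: ub_le_sup => //.
exists ((nrm x)^-1 *: x); last first.
  by rewrite -scalemxAr is_normZ // ger0_norm ?invr_ge0 ?nrm_ge0 // mulrC.
by rewrite /= is_normZ // ger0_norm ?invr_ge0 ?nrm_ge0 // mulVf.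
Qed.

End norm_theory.

(** * Window costs and their minimizers *)

Section window.
Context (R : realType) (n : nat) (A B : 'M[R]_n) (nrm : 'cV[R]_n -> R).
Context (c : nat -> 'cV[R]_n -> R) (m : R).

Local Notation cost := (window_cost A B nrm c).
Local Notation gain := (induced_norm nrm (invmx B *m A)).
Implicit Types (y z : nat -> 'cV[R]_n).

Lemma eq_window_cost a b y z :
  (forall t, (a.-1 <= t <= b)%N -> y t = z t) -> cost a b y = cost a b z.
Proof.
move=> yz; apply: eq_big_nat => t /andP[at_ tb].
by rewrite !yz //; lia.
Qed.

Hypotheses (hnrm : is_norm nrm) (m0 : 0 < m).
Hypothesis hsc : forall t, strongly_convex nrm m (c t).
Hypothesis hc0 : forall t (x : 'cV[R]_n), 0 <= c t x.

Lemma window_cost_ge0 a b y : 0 <= cost a b y.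
Proof.
by rewrite /window_cost; apply: sumr_ge0 => t _; rewrite addr_ge0 ?hc0 ?(nrm_ge0 hnrm).
Qed.

Lemma window_cost_strongly_convex a b y z (l : R) : 0 <= l <= 1 ->
  cost a b (l *: y + (1 - l) *: z) <= l * cost a b y + (1 - l) * cost a b z
    - m / 2 * l * (1 - l) * \sum_(a <= t < b.+1) nrm (y t - z t) ^+ 2.
Proof.
move=> l01; rewrite /window_cost !mulr_sumr -big_split -sumrB /=.
apply: ler_sum => t _.
have h1 := hsc t (y t) (z t) l01.
have h2 := nrm_convex_comb hnrm (invmx B *m (y t - A *m y t.-1))
  (invmx B *m (z t - A *m z t.-1)) l01.
rewrite !fctE (_ : invmx B *m (_ - _)
  = l *: (invmx B *m (y t - A *m y t.-1))
    + (1 - l) *: (invmx B *m (z t - A *m z t.-1))); first by lra.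
rewrite !scalemxAr -mulmxDr; congr (_ *m _).
rewrite mulmxDr -!scalemxAr !scalerBr opprD; exact: addrACA.
Qed.

Lemma window_cost_convex a b : is_convex (cost a b).
Proof.
move=> y z l l01; apply: le_trans (window_cost_strongly_convex a b y z l01) _.
rewrite gerBl; case/andP: l01 => l0 l1.
have S0 : 0 <= \sum_(a <= t < b.+1) nrm (y t - z t) ^+ 2.
  by apply: sumr_ge0 => t _; rewrite sqr_ge0.
by rewrite !mulr_ge0 ?invr_ge0 ?subr_ge0 // ltW.
Qed.

Definition window_minimal (a b : nat) y : Prop :=
  forall z, z a.-1 = y a.-1 -> cost a b y <= cost a b z.

(** Moving from the minimizer y towards z by a small weight l does not decrease
    the cost, while strong convexity bounds the cost of the moved point by the
    chord minus a term of order l; dividing by l and letting l tend to 0 gives the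
    quadratic gap. *)
Lemma window_minimal_gap a b y z : window_minimal a b y -> z a.-1 = y a.-1 ->
  cost a b y + m / 2 * \sum_(a <= t < b.+1) nrm (z t - y t) ^+ 2 <= cost a b z.
Proof.
move=> ymin za; set D := m / 2 * _.
have D0 : 0 <= D.
  rewrite mulr_ge0 //; first by rewrite divr_ge0 // ltW.
  by apply: sumr_ge0 => t _; rewrite sqr_ge0.
have gap l : 0 < l <= 1 -> cost a b y <= cost a b z - (1 - l) * D.
  case/andP=> l0 l1.
  have l01 : 0 <= l <= 1 by rewrite ltW.
  have e : (l *: z + (1 - l) *: y) a.-1 = y a.-1.
    by rewrite !fctE za -scalerDl addrC subrK scale1r.
  have := le_trans (ymin _ e) (window_cost_strongly_convex a b z y l01).
  rewrite [X in _ - X](_ : _ = l * ((1 - l) * D)); last by rewrite /D; ring.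
  move=> h; rewrite -(ler_pM2l l0); lra.
rewrite leNgt; apply/negP => lt.
set g := cost a b y + D - cost a b z.
have g0 : 0 < g by rewrite /g; lra.
have Dg : 0 < D + g by lra.
(* the weight for which the gap estimate contradicts a positive defect g *)
have := gap (g / (D + g)); rewrite divr_gt0 // ler_pdivrMr // mul1r lerDr D0.
move=> /(_ isT) h.
have : g <= g / (D + g) * D by rewrite /g in h *; lra.
rewrite mulrAC ler_pdivlMr //; nra.
Qed.

(** Minimality only compares y with trajectories issued from y (a - 1). The
    competitor is therefore z redirected to start from that point, which changes
    only the switching cost at time a. *)
Lemma window_minimal_le a b y z : (1 <= a <= b)%N -> window_minimal a b y ->
  cost a b y <= cost a b z + gain * nrm (z a.-1 - y a.-1)
                - m / 2 * nrm (z b - y b) ^+ 2.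
Proof.
case/andP=> a1 ab ymin.
pose z' t := if t == a.-1 then y t else z t.
have z'E t : (a <= t)%N -> z' t = z t by rewrite /z'; case: eqP => // ->; lia.
have z'a : z' a.-1 = y a.-1 by rewrite /z' eqxx.
have gap := window_minimal_gap ymin z'a.
have step : cost a b z' <= cost a b z + gain * nrm (z a.-1 - y a.-1).
  rewrite /window_cost !(@big_ltn _ _ _ a) ?ltnS //.
  rewrite (@eq_big_nat _ _ _ a.+1 b.+1 _
    (fun t => c t (z t) + nrm (invmx B *m (z t - A *m z t.-1)))); last first.
    by move=> t /andP[at_ _]; rewrite !z'E //; lia.
  rewrite z'a z'E //.
  have -> : invmx B *m (z a - A *m y a.-1) = invmx B *m (z a - A *m z a.-1)
      + invmx B *m A *m (z a.-1 - y a.-1).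
    by rewrite -mulmxA -mulmxDr; congr (_ *m _); rewrite mulmxBr addrA subrK.
  have := is_normD hnrm (invmx B *m (z a - A *m z a.-1))
    (invmx B *m A *m (z a.-1 - y a.-1)).
  have := induced_norm_le hnrm (invmx B *m A) (z a.-1 - y a.-1).
  lra.
have last_term :
    nrm (z b - y b) ^+ 2 <= \sum_(a <= t < b.+1) nrm (z' t - y t) ^+ 2.
  rewrite big_nat_recr //= z'E // lerDr.
  by apply: sumr_ge0 => t _; rewrite sqr_ge0.
have : m / 2 * nrm (z b - y b) ^+ 2
    <= m / 2 * \sum_(a <= t < b.+1) nrm (z' t - y t) ^+ 2.
  by rewrite ler_pM2l // divr_gt0.
lra.
Qed.

(** A window problem depends on finitely many coordinates, and strong convexity
    makes its sublevel sets bounded. The part of the trajectory before the window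
    can be prescribed, which lets successive windows be solved one after the
    other. *)
Lemma window_minimal_exists a b y0 : (1 <= a <= b)%N ->
  exists y, (forall t, (t < a)%N -> y t = y0 t) /\ window_minimal a b y.
Proof.
case/andP=> a1 ab; pose L := (b - a).+1.
pose traj (u : 'rV[R]_(L * n)) t : 'cV[R]_n :=
  if (t < a)%N then y0 t else (row (inord (t - a)) (vec_mx u : 'M[R]_(L, n)))^T.
pose f u := cost a b (traj u).
have trajD l u v : traj (l *: u + (1 - l) *: v) = l *: traj u + (1 - l) *: traj v.
  apply/funext => t; rewrite !fctE /traj; case: ifP => _.
    by rewrite -scalerDl addrC subrK scale1r.
  by rewrite !linearD !linearZ.
have cf : is_convex f.
  by move=> u v l l01; rewrite /f trajD; exact: window_cost_convex.
have traj_min u : (forall v, f u <= f v) -> window_minimal a b (traj u).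
  move=> umin z za.
  pose v := mxvec (\matrix_(i < L, j < n) z (a + i)%N j 0).
  apply: le_trans (umin v) _; rewrite /f le_eqVlt; apply/orP; left; apply/eqP.
  apply: eq_window_cost => t /andP[at_ tb]; rewrite /traj; case: ltnP => ta.
    have -> : t = a.-1 by lia.
    by rewrite za /traj; case: ltnP => //; lia.
  apply/colP => i; rewrite mxvecK !mxE inordK; last by rewrite /L; lia.
  by rewrite subnKC.
have [k k0 hk] := nrm_lower_bound hnrm.
pose r := Num.sqrt (8 * f 0 / m).
have sub u : f u <= f 0 -> `|u| <= k * r.
  move=> fu.
  have f0 : 0 <= f 0 by exact: window_cost_ge0.
  have l01 : 0 <= (2^-1 : R) <= 1 by lra.
  have := window_cost_strongly_convex a b (traj u) (traj 0) l01.
  have := window_cost_ge0 a b (2^-1 *: traj u + (1 - 2^-1) *: traj 0).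
  rewrite -/(f u) -/(f 0); set S := \sum_(_ <= _ < _) _ => h1 h2.
  (* at the midpoint of u and 0, strong convexity gives
     0 <= (f u + f 0) / 2 - m / 8 * S *)
  have hS : S <= 8 * f 0 / m.
    rewrite ler_pdivlMr //; nra.
  have coord i j : `|vec_mx u i j| <= k * r.
    have ib : (a + i <= b)%N by have := ltn_ord i; rewrite /L; lia.
    have e : (traj u (a + i)%N - traj 0 (a + i)%N) = (row i (vec_mx u))^T.
      rewrite /traj ltnNge leq_addr /= addKn inord_val.
      by rewrite linear0 row0 trmx0 subr0.
    have : nrm (row i (vec_mx u))^T ^+ 2 <= S.
      rewrite -e /S (big_cat_nat _ _ (n := (a + i)%N)) //=; try lia.
      rewrite (@big_ltn _ _ _ (a + i)%N) // ?ltnS // addrCA lerDl.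
      by rewrite addr_ge0 // sumr_ge0 // => t _; rewrite sqr_ge0.
    move=> /le_trans /(_ hS) h.
    have : nrm (row i (vec_mx u))^T <= r.
      by rewrite -(ger0_norm (nrm_ge0 hnrm _)) -sqrtr_sqr ler_wsqrtr.
    rewrite -(ler_pM2l k0) => /(le_trans (hk _)); apply: le_trans.
    rewrite [leRHS]mx_normrE.
    have := le_bigmax 0
      (fun ij : 'I_1 * 'I_n => `|row i (vec_mx u) ij.1 ij.2|) (0, j).
    by rewrite /= mxE.
  rewrite [leLHS]mx_normrE; apply: bigmax_le => [|[i kk] _ /=].
    by rewrite mulr_ge0 ?sqrtr_ge0 // ltW.
  case/mxvec_indexP: kk => i' j; have := coord i' j.
  by rewrite mxE ord1.
have [u umin] := convex_coercive_min cf sub.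
exists (traj u); split; last exact: traj_min.
by move=> t ta; rewrite /traj ta.
Qed.

End window.

(** * Fixed horizon control *)

Section fhc.
Context (R : realType) (n : nat) (A B : 'M[R]_n) (nrm : 'cV[R]_n -> R).
Context (c : nat -> 'cV[R]_n -> R) (m : R).
Hypotheses (hnrm : is_norm nrm) (m0 : 0 < m).
Hypothesis hsc : forall t, strongly_convex nrm m (c t).
Hypothesis hc0 : forall t (x : 'cV[R]_n), 0 <= c t x.
Context (T w : nat).

Local Notation cost := (window_cost A B nrm c).
Local Notation gain := (induced_norm nrm (invmx B *m A)).
Local Notation minimal := (window_minimal A B nrm c).
Implicit Types (y z : nat -> 'cV[R]_n).

(** The windows are solved in chronological order: extending a trajectory beyond
    time j + k (w + 1) - 1 leaves the earlier windows untouched. *)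
Lemma fhc_exists j : (1 <= j)%N -> exists y, is_fhc A B nrm T w j c y.
Proof.
move=> j1.
have partial k : exists y, y 0%N = 0 /\ forall a b,
    fhc_window T w j a b -> (a < j + k * w.+1)%N -> minimal a b y; last first.
  have [y [y0 ymin]] := partial T.
  exists y; split=> // a b ab; apply: ymin => //.
  case: ab => [[k [-> aT _]]|[j1' -> _]]; nia.
elim: k => [|k IH].
  rewrite mul0n addn0.
  have [j2|j2] := leqP 2 j; last first.
    exists (fun=> 0); split=> // a b [[k [-> _ _]]|[]]; lia.
  have [T0|T0] := posnP T.
    exists (fun=> 0); split=> // a b [[k [-> aT _]]|[_ -> ->]]; first lia.
    by move=> _ z _; rewrite /window_cost T0 minn0 !big_geq.
  have ab : (1 <= 1 <= minn j.-1 T)%N by lia.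
  have [y [yl ymin]] := window_minimal_exists A B hnrm m0 hsc hc0 (fun=> 0) ab.
  exists y; split; first by rewrite yl.
  by move=> a b [[k [-> _ _]]|[_ -> ->]] //; lia.
have [y [y0 ymin]] := IH.
pose s := (j + k * w.+1)%N.
(* s is the start of the next window, if it is within the horizon *)
have [sT|Ts] := leqP s T; last first.
  exists y; split=> // a b hab alt; apply: ymin => //.
  case: hab => [[i [ai aT _]]|[]]; rewrite ?/s in Ts; nia.
have ab : (1 <= s <= minn (s + w) T)%N by rewrite /s; lia.
have [z [zl zmin]] := window_minimal_exists A B hnrm m0 hsc hc0 y ab.
exists z; split; first by rewrite zl // /s; lia.
move=> a b hab alt.
(* a window starting before s + w + 1 is either the new one or already over *)
have [[-> ->]|[sa bs]] : (a = s /\ b = minn (s + w) T) \/ (a.-1 < s /\ b < s)%N.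
  move: alt; case: hab => [[i [-> aT ->]]|[_ -> ->]] alt; last first.
    by right; rewrite /s; lia.
  have [ik|ik] := leqP k i.
    have -> : i = k by nia.
    by left.
  right.
  have : (i.+1 * w.+1 <= k * w.+1)%N by rewrite leq_mul2r ik orbT.
  rewrite /s mulSn; lia.
  exact: zmin.
move=> x xa; have -> : cost a b z = cost a b y.
  by apply: eq_window_cost => t /andP[_ tb]; apply: zl; lia.
apply: ymin => //; last by rewrite xa zl.
move: bs; case: hab => [[i [-> aT ->]]|[j2 -> _]]; rewrite /s; lia.
Qed.

(** The induction runs over the windows. The term - m / 2 * d e ^ 2 left over at
    the end e of the treated windows pays for the quadratic part of the loss
    caused by restarting from y e instead of z e. The sum counts the windows
    started so far, the truncated one excepted. *)
Lemma fhc_prefix_le j y z k : (1 <= j <= w.+1)%N -> is_fhc A B nrm T w j c y ->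
  z 0%N = 0 ->
  let e := minn (j + k * w.+1).-1 T in
  cost 1 e y <= cost 1 e z - m / 2 * nrm (z e - y e) ^+ 2
    + gain ^+ 2 / (2 * m) * (\sum_(0 <= i < k) (j + i * w.+1 <= T)%N)%:R.
Proof.
move=> /andP[j1 jw] [y0 ymin] z0; elim: k => [|k IH] /=.
  rewrite mul0n addn0 big_nil mulr0 addr0.
  set e := minn _ _.
  (* for j = 1 there is no truncated window, and nothing has been treated yet *)
  have [e0|e0] := posnP e.
    by rewrite /window_cost e0 !big_geq // y0 z0 subrr nrm0 // expr0n /= mulr0 subr0.
  have wmin : minimal 1 e y by apply: ymin; right; split; rewrite ?/e in e0 *; lia.
  have e1 : (1 <= 1 <= e)%N by rewrite e0.
  have := window_minimal_le hnrm m0 hsc z e1 wmin.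
  by rewrite /= y0 z0 subrr nrm0 // mulr0 addr0.
rewrite big_nat_recr //=; move: IH => /=.
set s := (j + k * w.+1)%N; set e := minn _ _; set N := (\sum_(_ <= _ < _) _)%N.
have [sT|Ts] := leqP s T; last first.
  by rewrite addn0 (_ : minn _ T = e) // /e mulSn; rewrite /s in Ts *; lia.
set e' := minn _ _ => IH.
have es : e = s.-1 by rewrite /e; lia.
have s1 : (1 <= s)%N by rewrite /s; lia.
have e'E : e' = minn (s + w) T by rewrite /e' /s mulSn; congr minn; lia.
have se' : (s <= e')%N by rewrite e'E; lia.
have wmin : minimal s e' y by apply: ymin; left; exists k; split.
have split_cost x : cost 1 e' x = cost 1 e x + cost s e' x.
  rewrite /window_cost (@big_cat_nat _ _ _ s) //=; last by lia.
  by rewrite es prednK.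
have sle : (1 <= s <= e')%N by rewrite s1.
have := window_minimal_le hnrm m0 hsc z sle wmin; rewrite -es.
set d := nrm (z e - y e) in IH * => wle.
have amgm : gain * d <= gain ^+ 2 / (2 * m) + m / 2 * d ^+ 2.
  rewrite -subr_ge0.
  have -> : gain ^+ 2 / (2 * m) + m / 2 * d ^+ 2 - gain * d
    = (gain - m * d) ^+ 2 / (2 * m) by field; rewrite ?gt_eqF.
  by rewrite divr_ge0 ?sqr_ge0 // mulr_ge0 // ltW.
rewrite !split_cost natrD mulrDr mulr1; lra.
Qed.

(** The map (j, i) |-> j + i (w + 1), for 1 <= j <= w + 1, is the Euclidean
    division of times by w + 1, hence takes each value once. *)
Lemma sum_window_starts_le :
  (\sum_(1 <= j < w.+2) \sum_(0 <= i < T) (j + i * w.+1 <= T)%N <= T)%N.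
Proof.
rewrite exchange_big_nat /=.
have -> : (\sum_(0 <= i < T) \sum_(1 <= j < w.+2) (j + i * w.+1 <= T) =
           \sum_(0 <= t < T * w.+1) (t < T))%N.
  rewrite big_nat_mul; apply: eq_bigr => i _.
  rewrite big_add1 /= -[X in _ = \sum_(X <= _ < _) _]add0n big_addn mulSn addnK.
  by apply: eq_bigr => j _; rewrite addSn.
rewrite (big_cat_nat _ _ (n := T)) //=; last by rewrite leq_pmulr.
rewrite [X in (_ + X)%N]big1_seq ?addn0; last first.
  by move=> t /andP[_]; rewrite mem_index_iota => /andP[Tt _]; rewrite ltnNge Tt.
by rewrite (leq_trans (leq_sum _ (fun i _ => leq_b1 _))) // sum_nat_const_nat muln1 subn0.
Qed.

Lemma fhc_sum_le z : z 0%N = 0 ->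
  \sum_(1 <= j < w.+2) cost 1 T (fhc A B nrm T w j c)
    <= w.+1%:R * cost 1 T z + gain ^+ 2 / (2 * m) * T%:R.
Proof.
move=> z0.
have G0 : 0 <= gain ^+ 2 / (2 * m).
  by rewrite divr_ge0 ?sqr_ge0 // mulr_ge0 // ltW.
apply: (@le_trans _ _ (\sum_(1 <= j < w.+2) (cost 1 T z
    + gain ^+ 2 / (2 * m) * (\sum_(0 <= i < T) (j + i * w.+1 <= T)%N)%:R))).
  apply: ler_sum_nat => j /andP[j1 jw].
  have hfhc := xgetPex (fun=> 0) (fhc_exists j1).
  have j1w : (1 <= j <= w.+1)%N by rewrite j1 -ltnS.
  have := fhc_prefix_le T j1w hfhc z0.
  rewrite /= -/(fhc A B nrm T w j c) (_ : minn _ T = T); last by nia.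
  have : 0 <= m / 2 * nrm (z T - fhc A B nrm T w j c T) ^+ 2.
    by rewrite mulr_ge0 ?sqr_ge0 // divr_ge0 // ltW.
  lra.
rewrite big_split /= -mulr_sumr -natr_sum sumr_const_nat subn1 /= [w.+1%:R * _]mulr_natl.
by rewrite lerD2l ler_wpM2l // ler_nat sum_window_starts_le.
Qed.

Lemma afhc_cost_le z : z 0%N = 0 ->
  cost 1 T (afhc A B nrm T w c)
    <= cost 1 T z + gain ^+ 2 / (2 * m * w.+1%:R) * T%:R.
Proof.
move=> z0.
have w0 : (0 : R) < w.+1%:R by rewrite ltr0n.
have := convex_uniform_mean (window_cost_convex A B hnrm m0 hsc 1 T)
  (fun i : 'I_w.+1 => fhc A B nrm T w i.+1 c).
rewrite (_ : _ *: _ = afhc A B nrm T w c); last first.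
  apply/funext => t; rewrite /afhc !fctE; congr (_ *: _).
  by rewrite fct_sumE big_add1 big_mkord.
move/le_trans; apply.
rewrite mulrC ler_pdivrMr //.
have := fhc_sum_le z0; rewrite big_add1 big_mkord => /le_trans; apply.
rewrite le_eqVlt; apply/orP; left; apply/eqP.
by field; rewrite !gt_eqF.
Qed.

Lemma afhc0 : afhc A B nrm T w c 0%N = 0.
Proof.
rewrite /afhc big_nat big1 ?scaler0 // => j /andP[j1 _].
by have [] := xgetPex (fun=> 0) (fhc_exists j1).
Qed.

End fhc.

(** * Competitive ratio *)

Section ratio.
Context (R : realType) (n : nat) (A B : 'M[R]_n) (nrm : 'cV[R]_n -> R).
Context (c : nat -> 'cV[R]_n -> R) (m c0 : R).
Hypotheses (hnrm : is_norm nrm) (m0 : 0 < m) (c0_gt0 : 0 < c0).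
Hypothesis hsc : forall t, strongly_convex nrm m (c t).
Hypothesis hlb : forall t (x : 'cV[R]_n), c0 <= c t x.
Context (T w : nat).
Hypothesis T0 : (1 <= T)%N.

Local Notation cost := (window_cost A B nrm c).
Local Notation opt := (offline_opt A B nrm c T).
Local Notation alg := (afhc A B nrm T w c).
Local Notation gain := (induced_norm nrm (invmx B *m A)).

Lemma stage_cost_ge0 t (x : 'cV[R]_n) : 0 <= c t x.
Proof. exact: le_trans (ltW c0_gt0) (hlb t x). Qed.

Lemma feasible_costs_neq0 :
  [set cost 1 T y | y in [set y | y 0%N = 0]] !=set0.
Proof. by exists (cost 1 T (fun=> 0)); exists (fun=> 0). Qed.

Lemma offline_opt_ge : T%:R * c0 <= opt.
Proof.
apply: lb_le_inf; first exact: feasible_costs_neq0.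
move=> _ [y _ <-].
have -> : T%:R * c0 = \sum_(1 <= t < T.+1) c0.
  by rewrite sumr_const_nat subn1 mulr_natl.
apply: ler_sum => t _.
by rewrite -[leLHS]addr0 lerD ?nrm_ge0.
Qed.

Lemma offline_opt_gt0 : 0 < opt.
Proof. by apply: lt_le_trans offline_opt_ge; rewrite mulr_gt0 // ltr0n. Qed.

Lemma afhc_ratio_ge1 : 1 <= cost 1 T alg / opt.
Proof.
rewrite ler_pdivlMr ?offline_opt_gt0 // mul1r; apply: ge_inf.
  exists 0 => _ [y _ <-]; exact: window_cost_ge0 hnrm stage_cost_ge0 _ _ _.
by exists alg => //=; exact: afhc0 hnrm m0 hsc stage_cost_ge0 _ _.
Qed.

Lemma afhc_ratio_le :
  cost 1 T alg / opt <= 1 + gain ^+ 2 / (2 * m * w.+1%:R * c0).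
Proof.
rewrite ler_pdivrMr ?offline_opt_gt0 //.
set G := gain ^+ 2 / (2 * m * w.+1%:R).
have G0 : 0 <= G by rewrite divr_ge0 ?sqr_ge0 // !mulr_ge0 // ltW.
have algle : cost 1 T alg <= opt + G * T%:R.
  rewrite -lerBlDr; apply: lb_le_inf; first exact: feasible_costs_neq0.
  move=> _ [y /= y0 <-]; rewrite lerBlDr.
  exact: afhc_cost_le hnrm m0 hsc stage_cost_ge0 _ _ _ y0.
apply: le_trans algle _.
have -> : gain ^+ 2 / (2 * m * w.+1%:R * c0) = G / c0 by rewrite invfM mulrA.
rewrite mulrDl mul1r lerD2l -[G / c0 * _]mulrA; apply: ler_wpM2l => //.
by rewrite mulrC ler_pdivlMr // offline_opt_ge.
Qed.

End ratio.

Theorem theorem1 (R : realType) (n : nat) (A B : 'M[R]_n)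
    (nrm : 'cV[R]_n -> R) (cx : 'cV[R]_n -> R) (m c0 : R)
    (hB : B \in unitmx) (hnrm : is_norm nrm)
    (hcx : convex_function (setT : set (convex_lmodType 'cV[R]_n)) cx)
    (hm : 0 < m) (hc0 : 0 < c0)
    (hsc : forall (v : nat -> 'cV[R]_n) (t : nat),
       strongly_convex nrm m (hitting cx v t))
    (hlb : forall (v : nat -> 'cV[R]_n) (t : nat) (y : 'cV[R]_n),
       c0 <= hitting cx v t y) :
  (forall T w : nat, (1 <= T)%N ->
     (competitive_ratio A B nrm cx T (afhc A B nrm T w)
      <= (1 + induced_norm nrm (invmx B *m A) ^+ 2
              / (2 * m * w.+1%:R * c0))%:E)%E) /\
  (exists C : R, forall T w : nat, (1 <= T)%N -> (1 <= w)%N ->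
     (`|competitive_ratio A B nrm cx T (afhc A B nrm T w) - 1|
      <= (C / w%:R)%:E)%E).
Proof.
have upper T w : (1 <= T)%N ->
   (competitive_ratio A B nrm cx T (afhc A B nrm T w)
    <= (1 + induced_norm nrm (invmx B *m A) ^+ 2
            / (2 * m * w.+1%:R * c0))%:E)%E.
  move=> T0; apply: ge_ereal_sup => _ [v _ <-]; rewrite lee_fin.
  by apply: afhc_ratio_le.
split=> //.
set K := induced_norm nrm (invmx B *m A) in upper *.
exists (K ^+ 2 / (2 * m * c0)) => T w T0 w0.
have lower : (1 <= competitive_ratio A B nrm cx T (afhc A B nrm T w))%E.
  pose v (t : nat) : 'cV[R]_n := 0.
  apply: (@le_trans _ _ (window_cost A B nrm (hitting cx v) 1 T
    (afhc A B nrm T w (hitting cx v)) / offline_opt A B nrm (hitting cx v) T)%:E).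
    rewrite lee_fin.
    exact: (@afhc_ratio_ge1 _ _ A B nrm _ m c0).
  by apply: ereal_sup_ubound; exists v.
have w_gt0 : (0 : R) < w%:R by rewrite ltr0n.
rewrite gee0_abs ?sube_ge0 // leeBlDr //.
apply: le_trans (upper T w T0) _.
rewrite -EFinD lee_fin addrC lerD2r.
rewrite -[leRHS]mulrA -invfM; apply: ler_wpM2l; first exact: sqr_ge0.
rewrite lef_pV2 ?posrE ?mulr_gt0 // [leRHS]mulrAC; apply: ler_wpM2l.
  by rewrite !mulr_ge0 // ltW.
by rewrite ler_nat.
Qed.
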